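(* Let $n\geq m\geq 1$ be integers, $S_{n,m}=K[x_1,\ldots,x_n,y_1,\ldots,y_m]$ and $I_{n,m}=(x_iy_j : 1\leq i\leq n,\ 1\leq j\leq m)\subset S_{n,m}$. Then $$\operatorname{hdepth}(S_{n,m}/I_{n,m})\geq \left\lceil \frac{n}{2} \right\rceil.$$
   Context: $K$ is a field. Polynomial rings over $K$ carry the standard grading (each variable has degree 1). For a finitely generated graded module $M$ over a polynomial ring $S$ over $K$, the Hilbert depth $\operatorname{hdepth}(M)$ is the maximal depth of a finitely generated graded $S$-module $N$ having the same Hilbert series as $M$. *)

(* Defs.v *)
From HB Require Import structures.
From mathcomp Require Import all_boot all_order all_algebra.
From mathcomp Require Import generic_quotient ring_quotient.
From mathcomp Require Import mpoly boolp.

Set Implicit Arguments.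
Unset Strict Implicit.
Unset Printing Implicit Defensive.

Import GRing.Theory.

Local Open Scope ring_scope.
Local Open Scope quotient_scope.

(* [{ideal_quot N}] carries only an additive structure (a ring structure when N
   is a proper ideal); this adds the module structure of V / N. *)
Section QuotientModule.
Variables (A : nzRingType) (V : lmodType A) (N : submodClosed V).

Definition submod_pred : {pred V} := fun v => v \in N.

Lemma submod_zmod_closed : zmod_closed submod_pred.
Proof.
split=> [|u v uN vN]; first exact: (rpred0 N).
by rewrite -scaleN1r; apply: (rpredD (S := N)) => //; apply: rpredZ.
Qed.

HB.instance Definition _ :=
  GRing.isZmodClosed.Build V submod_pred submod_zmod_closed.

Definition quotmod : Type := {ideal_quot submod_pred}.
HB.instance Definition _ := GRing.Zmodule.on quotmod.

Definition quotmod_pi (v : V) : quotmod := \pi_{ideal_quot submod_pred} v.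

Lemma quotmod_piB u v : quotmod_pi (u - v) = quotmod_pi u - quotmod_pi v.
Proof. exact: (raddfB (\pi_{ideal_quot submod_pred})). Qed.

HB.instance Definition _ :=
  GRing.isZmodMorphism.Build V quotmod quotmod_pi quotmod_piB.

Lemma quotmod_pi_eq0 v : (quotmod_pi v = 0) <-> (v \in N).
Proof.
rewrite -(raddf0 quotmod_pi) /quotmod_pi.
have := Quotient.idealrBE submod_pred v 0.
rewrite subr0 -[_ \in submod_pred]/(v \in N) => ->.
by split=> /eqP.
Qed.

Lemma quotmod_pi_surj (x : quotmod) : exists v, x = quotmod_pi v.
Proof. by exists (repr (x : {ideal_quot submod_pred})); rewrite /quotmod_pi reprK. Qed.

Definition quotmod_scale (a : A) (x : quotmod) : quotmod :=
  quotmod_pi (a *: repr (x : {ideal_quot submod_pred})).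

Lemma quotmod_scale_pi a v :
  quotmod_scale a (quotmod_pi v) = quotmod_pi (a *: v).
Proof.
apply/eqP; rewrite -subr_eq0; apply/eqP.
rewrite -raddfB -scalerBr; apply/quotmod_pi_eq0; apply: rpredZ.
by apply/quotmod_pi_eq0; rewrite raddfB /= /quotmod_pi reprK subrr.
Qed.

Lemma quotmod_scaleA a b x :
  quotmod_scale a (quotmod_scale b x) = quotmod_scale (a * b) x.
Proof. by case: (quotmod_pi_surj x) => v ->; rewrite !quotmod_scale_pi scalerA. Qed.

Lemma quotmod_scale1 : left_id 1 quotmod_scale.
Proof. by move=> x; case: (quotmod_pi_surj x) => v ->; rewrite quotmod_scale_pi scale1r. Qed.

Lemma quotmod_scaleDr : right_distributive quotmod_scale +%R.
Proof.
move=> a x y; case: (quotmod_pi_surj x) => u ->; case: (quotmod_pi_surj y) => v ->.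
by rewrite -raddfD !quotmod_scale_pi scalerDr raddfD.
Qed.

Lemma quotmod_scaleDl x : {morph quotmod_scale^~ x : a b / a + b}.
Proof.
move=> a b; case: (quotmod_pi_surj x) => v ->.
by rewrite !quotmod_scale_pi scalerDl raddfD.
Qed.

HB.instance Definition _ := GRing.Zmodule_isLmodule.Build A quotmod
  quotmod_scaleA quotmod_scale1 quotmod_scaleDr quotmod_scaleDl.

Lemma quotmod_piZ a v : quotmod_pi (a *: v) = a *: quotmod_pi v.
Proof. by rewrite -quotmod_scale_pi. Qed.

End QuotientModule.

Section GradedModules.
Variables (K : fieldType) (r : nat).
Local Notation S := {mpoly K[r]}.

(* Finitely generated Z-graded S-modules.  The components are K-subspaces:
   closure under scalars is [gr_scale] at i = 0. *)
Record fgGrModule := FGGrModule {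
  gr_sort :> lmodType S;
  gr : int -> gr_sort -> Prop;
  gr_0 : forall k, gr k 0;
  gr_B : forall k u v, gr k u -> gr k v -> gr k (u - v);
  gr_scale : forall (i : nat) (k : int) (p : S) v,
    p \is i.-homog -> gr k v -> gr (i%:Z + k) (p *: v);
  gr_span : forall v, exists (s : seq int) (f : int -> gr_sort),
    (forall k, gr k (f k)) /\ v = \sum_(k <- s) f k;
  gr_free : forall (s : seq int) (f : int -> gr_sort),
    uniq s -> (forall k, gr k (f k)) -> \sum_(k <- s) f k = 0 ->
    forall k, k \in s -> f k = 0;
  gr_fg : exists (g : nat) (e : 'I_g -> gr_sort),
    forall v, exists c : 'I_g -> S, v = \sum_i c i *: e i
}.

Definition has_dim (M : lmodType S) (V : M -> Prop) (d : nat) : Prop :=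
  exists e : 'I_d -> M, (forall i, V (e i)) /\
    forall v, V v -> exists! c : 'rV[K]_d, v = \sum_i (c 0 i)%:MP *: e i.

(* h : int -> nat stands for the series \sum_k h(k) t^k. *)
Definition has_hilbert_series (M : fgGrModule) (h : int -> nat) : Prop :=
  forall k, has_dim (@gr M k) (h k).

Definition same_hilbert_series (M N : fgGrModule) : Prop :=
  exists h, has_hilbert_series M h /\ has_hilbert_series N h.

(* The submodule (x_1, ..., x_l) M. *)
Definition in_seq_smul (M : lmodType S) (x : seq S) (v : M) : Prop :=
  exists w : 'I_(size x) -> M, v = \sum_(i < size x) x`_i *: w i.

(* M-regular sequences in the ideal generated by the variables: each x_i is a
   nonzerodivisor on M / (x_1, ..., x_(i-1)) M, and (x_1, ..., x_l) M <> M. *)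
Definition regular_seq (M : lmodType S) (x : seq S) : Prop :=
  [/\ forall i, (i < size x)%N -> (x`_i)@_0%MM = 0,
      forall i, (i < size x)%N -> forall v : M,
        in_seq_smul (take i x) (x`_i *: v) -> in_seq_smul (take i x) v
    & exists v : M, ~ in_seq_smul x v].

(* The zero module has no regular sequence, hence no depth in this sense. *)
Definition is_depth (M : lmodType S) (d : nat) : Prop :=
  (exists x, regular_seq M x /\ size x = d) /\
  (forall x, regular_seq M x -> (size x <= d)%N).

Definition is_hdepth (M : fgGrModule) (d : nat) : Prop :=
  (exists N : fgGrModule, same_hilbert_series M N /\ is_depth N d) /\
  (forall (N : fgGrModule) (d' : nat),
     same_hilbert_series M N -> is_depth N d' -> (d' <= d)%N).

Section HomogeneousQuotient.
Variables (J : finType) (g : J -> S) (dg : J -> nat).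
Hypothesis g_homog : forall j, g j \is (dg j).-homog.

Definition ideal_gen : {pred S^o} :=
  fun p => `[< exists c : J -> S, p = \sum_j c j * g j >].

Lemma ideal_genP (p : S) :
  p \in ideal_gen <-> exists c : J -> S, p = \sum_j c j * g j.
Proof. by split=> /asboolP. Qed.

Lemma ideal_gen_closed : submod_closed ideal_gen.
Proof.
split=> [|a p q /ideal_genP[c ->] /ideal_genP[c' ->]]; apply/ideal_genP.
  by exists (fun=> 0); rewrite big1 // => j _; rewrite mul0r.
exists (fun j => a * c j + c' j).
rewrite [_ *: _]mulr_sumr -big_split; apply: eq_bigr => j _ /=.
by rewrite mulrDl mulrA.
Qed.

HB.instance Definition _ :=
  GRing.isSubmodClosed.Build S S^o ideal_gen ideal_gen_closed.

Definition idealquot : lmodType S := quotmod ideal_gen.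
Definition idealquot_pi (p : S) : idealquot := @quotmod_pi S S^o ideal_gen p.

Lemma idealquot_pi_sum (I : Type) (s : seq I) (P : pred I) (F : I -> S) :
  idealquot_pi (\sum_(i <- s | P i) F i) = \sum_(i <- s | P i) idealquot_pi (F i).
Proof. exact: (raddf_sum (@quotmod_pi S S^o ideal_gen)). Qed.

(* For k < 0 the condition on p forces p = 0. *)
Definition idealquot_gr (k : int) (v : idealquot) : Prop :=
  exists p : S, {in msupp p, forall m, (mdeg m)%:Z = k} /\ v = idealquot_pi p.

Lemma idealquot_gr0 k : idealquot_gr k 0.
Proof. by exists 0; split; [move=> m; rewrite msupp0|rewrite /idealquot_pi raddf0]. Qed.

Lemma idealquot_grB k u v :
  idealquot_gr k u -> idealquot_gr k v -> idealquot_gr k (u - v).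
Proof.
move=> [p [hp ->]] [q [hq ->]]; exists (p - q); split; last first.
  by rewrite /idealquot_pi raddfB.
by move=> m /msuppB_le; rewrite mem_cat => /orP[/hp|/hq].
Qed.

Lemma idealquot_gr_scale (i : nat) (k : int) (p : S) v :
  p \is i.-homog -> idealquot_gr k v -> idealquot_gr (i%:Z + k) (p *: v).
Proof.
move=> hp [q [hq ->]]; exists (p * q); split; last first.
  by rewrite /idealquot_pi -quotmod_piZ.
move=> m /msuppM_le /allpairsP[[m1 m2] /= [h1 h2 ->]].
by rewrite mdegD PoszD (hq _ h2) (dhomog_mf hp h1).
Qed.

Lemma idealquot_gr_span v : exists (s : seq int) (f : int -> idealquot),
  (forall k, idealquot_gr k (f k)) /\ v = \sum_(k <- s) f k.
Proof.
have [p ->] := quotmod_pi_surj v.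
exists (map Posz (index_iota 0 (msize p))).
exists (fun k => if k is Posz d then idealquot_pi (pihomog mdeg d p) else 0).
split=> [[d|d]|]; last 1 first.
- rewrite big_map big_mkord -idealquot_pi_sum.
  by rewrite -(pihomog_partitionE (mf := mdeg) (leqnn (msize p))).
- exists (pihomog mdeg d p); split=> // m.
  by move/(dhomog_mf (pihomogP mdeg d p)) => /= ->.
- exact: idealquot_gr0.
Qed.

Lemma ideal_gen_pihomog d (p : S) :
  p \in ideal_gen -> (pihomog mdeg d p : S) \in ideal_gen.
Proof.
move=> /ideal_genP[c ->]; rewrite raddf_sum; apply: rpred_sum => j _ /=.
rewrite (pihomog_partitionE (mf := mdeg) (leqnn (msize (c j)))).
rewrite mulr_suml raddf_sum; apply: rpred_sum => a _ /=.
have hom : pihomog mdeg a (c j) * g j \is (a + dg j).-homog.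
  by apply: dhomogM; [exact: pihomogP|exact: g_homog].
have [<-|ne] := eqVneq (a + dg j)%N d; last first.
  by rewrite (pihomog_ne0 ne hom) rpred0.
rewrite (pihomog_dE hom); apply/ideal_genP.
exists (fun j' => if j' == j then pihomog mdeg a (c j) else 0).
rewrite (bigD1 j) //= eqxx big1 ?addr0 // => j' /negPf ->.
by rewrite mul0r.
Qed.

Lemma idealquot_gr_free (s : seq int) (f : int -> idealquot) :
  uniq s -> (forall k, idealquot_gr k (f k)) -> \sum_(k <- s) f k = 0 ->
  forall k, k \in s -> f k = 0.
Proof.
move=> us /choice[p hp] sum0 k ks.
have [hk ->] := hp k.
apply/quotmod_pi_eq0.
case: k ks hk => [d|d] ks hk; last first.
  suff -> : p (Negz d) = 0 by exact: rpred0.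
  by apply/mpolyP=> m; rewrite mcoeff0; apply: memN_msupp_eq0; apply/negP => /hk.
have /(ideal_gen_pihomog d) : (\sum_(k <- s) p k : S) \in ideal_gen.
  apply/quotmod_pi_eq0; rewrite raddf_sum -[RHS]sum0.
  by apply: eq_bigr => k _; have [] := hp k.
rewrite raddf_sum (bigD1_seq (Posz d)) //= big1 => [|k kd].
  rewrite addr0 pihomog_dE //; apply/dhomogP => m /hk.
  by case.
rewrite pihomogE big_seq_cond big1 // => m /andP[/(proj1 (hp k)) mk /eqP md].
by rewrite -mk md eqxx in kd.
Qed.

Lemma idealquot_fg : exists (l : nat) (e : 'I_l -> idealquot),
  forall v, exists c : 'I_l -> S, v = \sum_i c i *: e i.
Proof.
exists 1%N, (fun=> idealquot_pi 1) => v; have [p ->] := quotmod_pi_surj v.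
exists (fun=> p); rewrite big_ord1 /idealquot_pi -quotmod_piZ.
by congr quotmod_pi; rewrite [RHS]mulr1.
Qed.

Definition gr_idealquot : fgGrModule :=
  FGGrModule idealquot_gr0 idealquot_grB idealquot_gr_scale
    idealquot_gr_span idealquot_gr_free idealquot_fg.

End HomogeneousQuotient.

End GradedModules.

Section CompleteBipartite.
Variables (K : fieldType) (n m : nat).

(* K[x_1..x_n, y_1..y_m] is {mpoly K[n + m]}: the first n variables are the
   x_i and the last m are the y_j. *)
Definition xy_gen (ij : 'I_n * 'I_m) : {mpoly K[n + m]} :=
  'X_(lshift m ij.1) * 'X_(rshift n ij.2).

Lemma xy_gen_homog ij : xy_gen ij \is 2.-homog.
Proof. by apply: (@dhomogM _ _ mdeg 1 _ 1); rewrite dhomogX /= mdeg1. Qed.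

Definition quotient_SI : fgGrModule K (n + m) :=
  gr_idealquot (dg := fun=> 2%N) xy_gen_homog.

End CompleteBipartite.

(* Main.v *)
(* The Hilbert series of S/I is H = (1-t)^-n + (1-t)^-m - 1.  With
   d = uphalf n, the power series (1-t)^d H has nonnegative coefficients and
   agrees in large degrees with (1-t)^-(n-d) + (1-t)^-(m-d) (without the second
   term if m < d).  Hence H is a finite sum of series t^k (1-t)^-b with
   d <= b <= n, and the direct sum of the corresponding shifted modules
   K[X_0, ..., X_(b-1)](-k) has the Hilbert series H and the regular sequence
   X_0, ..., X_(d-1).

   The maximum exists because regular sequences have length at most the number
   r of variables: if v is not in xM, then the monomials in x_1, ..., x_l,
   applied to v, are linearly independent over K, so that D^l of them fit into
   a space of polynomials of dimension O(D^r). *)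
Require Import Defs.
From mathcomp Require Import all_boot all_order all_algebra.
From mathcomp Require Import mpoly boolp zify ring.

Set Implicit Arguments.
Unset Strict Implicit.
Unset Printing Implicit Defensive.

Import Order.TTheory GRing.Theory Num.Theory.

(** * The length of regular sequences *)

Section RegularSequences.
Variables (K : fieldType) (r : nat).
Local Notation S := {mpoly K[r]}.
Local Open Scope ring_scope.

Section SequenceSubmodule.
Variables (M : lmodType S) (x : seq S).

Lemma in_seq_smul0 : in_seq_smul x (0 : M).
Proof. by exists (fun=> 0); rewrite big1 // => i _; rewrite scaler0. Qed.

Lemma in_seq_smulD (u v : M) : in_seq_smul x u -> in_seq_smul x v -> in_seq_smul x (u + v).
Proof.
move=> [w ->] [w' ->]; exists (fun i => w i + w' i).
by rewrite -big_split; apply: eq_bigr => i _; rewrite scalerDr.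
Qed.

Lemma in_seq_smulZ a (v : M) : in_seq_smul x v -> in_seq_smul x (a *: v).
Proof.
move=> [w ->]; exists (fun i => a *: w i).
by rewrite scaler_sumr; apply: eq_bigr => i _; rewrite !scalerA mulrC.
Qed.

Lemma in_seq_smul_sum (I : Type) (s : seq I) (P : pred I) (F : I -> M) :
  (forall i, P i -> in_seq_smul x (F i)) -> in_seq_smul x (\sum_(i <- s | P i) F i).
Proof.
move=> hF; elim/big_ind: _ => //; [exact: in_seq_smul0|exact: in_seq_smulD].
Qed.

Lemma in_seq_smul_nth i (v : M) : (i < size x)%N -> in_seq_smul x (x`_i *: v).
Proof.
move=> ix; exists (fun j => if j == Ordinal ix then v else 0).
rewrite (bigD1 (Ordinal ix)) //= eqxx big1 ?addr0 // => j /negPf ->.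
by rewrite scaler0.
Qed.

End SequenceSubmodule.

Lemma in_seq_smul_take (M : lmodType S) (x : seq S) i (v w : M) : (i < size x)%N ->
  in_seq_smul (take i x) (v + x`_i *: w) -> in_seq_smul (take i.+1 x) v.
Proof.
move=> ix [u hu]; have -> : v = (v + x`_i *: w) - x`_i *: w by rewrite addrK.
apply: in_seq_smulD; last first.
  rewrite -scalerN -(@nth_take i.+1) //; apply: in_seq_smul_nth.
  by rewrite size_takel.
rewrite hu; apply: in_seq_smul_sum => j _.
have ji : (j < i)%N.
  by apply: leq_trans (ltn_ord j) _; rewrite size_takel // ltnW.
rewrite nth_take //; have ji1 : (j < i.+1)%N by apply: ltnW.
have := @in_seq_smul_nth M (take i.+1 x) j (u j).
by rewrite nth_take //; apply; apply: leq_trans ji1 _; rewrite size_takel.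
Qed.

Definition lin_indep_mod (M : lmodType S) (P : M -> Prop) (J : finType) (u : J -> M) :=
  forall c : J -> K, P (\sum_j (c j)%:MP *: u j) -> forall j, c j = 0.

(* The constant term w_0 of a relation sum_a y^a w_a = 0 modulo P vanishes
   modulo Q = P + yM, and then y cancels. *)
Lemma lin_indep_mod_powers (M : lmodType S) (P Q : M -> Prop) (y : S) (J : finType)
    (u : J -> M) (D : nat) :
  (forall v w, P (v + y *: w) -> Q v) ->
  (forall v, P (y *: v) -> P v) ->
  lin_indep_mod Q u ->
  lin_indep_mod P (fun aj : 'I_D * J => y ^+ aj.1 *: u aj.2).
Proof.
move=> PQ yP hu c.
have -> : \sum_aj (c aj)%:MP *: (y ^+ aj.1 *: u aj.2) =
  \sum_(a < D) y ^+ a *: \sum_j (c (a, j))%:MP *: u j.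
  transitivity (\sum_(a < D) \sum_j (c (a, j))%:MP *: (y ^+ a *: u j)).
    by rewrite pair_bigA; apply: eq_bigr => -[].
  apply: eq_bigr => a _; rewrite scaler_sumr; apply: eq_bigr => j _.
  by rewrite !scalerA mulrC.
move=> h [a j]; move: h a j.
elim: D c => [|D IHD] c h; first by case.
move: h; rewrite big_ord_recl expr0 scale1r.
have -> : \sum_(i < D) y ^+ lift ord0 i *: \sum_j (c (lift ord0 i, j))%:MP *: u j =
  y *: \sum_(i < D) y ^+ i *: \sum_j (c (lift ord0 i, j))%:MP *: u j.
  by rewrite scaler_sumr; apply: eq_bigr => i _; rewrite scalerA -exprS.
move=> h.
have c0 := hu _ (PQ _ _ h).
rewrite big1 ?add0r in h; last by move=> j _; rewrite c0 scale0r.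
have cS := IHD (fun aj => c (lift ord0 aj.1, aj.2)) (yP _ h).
by move=> a j; case: (unliftP ord0 a) => [a' ->|->]; [exact: cS|exact: c0].
Qed.

(** [msize] is the total degree plus one, and 0 for the zero polynomial. The asymmetric bounds [k]
    and [l.+1] absorb this offset. *)
Lemma msizeM_le (p q : S) k l :
  (msize p <= k)%N -> (msize q <= l.+1)%N -> (msize (p * q) <= k + l)%N.
Proof.
move=> hp hq; have [->|p0] := eqVneq p 0; first by rewrite mul0r msize0.
have [->|q0] := eqVneq q 0; first by rewrite mulr0 msize0.
by rewrite msizeM // -subn1 leq_subLR add1n -addnS leq_add.
Qed.

Lemma msize_exp_le (p : S) k a : (msize p <= k)%N -> (msize (p ^+ a) <= (a * k).+1)%N.
Proof.
move=> hp; elim: a => [|a IHa]; first by rewrite expr0 msize1.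
by rewrite exprS mulSn -addnS (leq_trans (msizeM_le hp IHa)) // leq_add2l.
Qed.

(** The [p j] are the monomials with exponents below [D] in the last [i] entries of [x]. The
    induction starts at the end of the sequence: each step applies [lin_indep_mod_powers] to the
    entry just before those already used, and adds at most [D * E] to the degrees. *)
Lemma regular_seq_indep (M : lmodType S) (x : seq S) (v : M) (D E i : nat) :
  regular_seq M x -> ~ in_seq_smul x v ->
  (forall y, y \in x -> (msize y <= E)%N) -> (i <= size x)%N ->
  exists (J : finType) (p : J -> S),
    [/\ #|J| = (D ^ i)%N, forall j, (msize (p j) <= (i * D * E).+1)%N &
        lin_indep_mod (in_seq_smul (take (size x - i) x)) (fun j => p j *: v)].
Proof.
move=> [_ regx _] vx xE; elim: i => [_|i IHi ix].
  exists unit, (fun=> 1); split=> [|_|c]; rewrite ?card_unit ?msize1 //.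
  rewrite subn0 take_size (big_pred1 tt) /=; last by case.
  rewrite scale1r => h [].
  (* A nonzero scalar is invertible, so a nonzero multiple of [v] in xM would put [v] itself
     there. *)
  apply/eqP/negP => /negP c0; apply: vx.
  have -> : v = ((c tt)^-1)%:MP *: ((c tt)%:MP *: v).
    by rewrite scalerA -mpolyCM mulVf // scale1r.
  exact: in_seq_smulZ.
have [J [p [cJ hp ind]]] := IHi (ltnW ix).
set l := (size x - i.+1)%N; have lx : (l < size x)%N by lia.
have eqS : (size x - i)%N = l.+1 by lia.
exists ('I_D * J)%type, (fun aj : 'I_D * J => x`_l ^+ aj.1 * p aj.2); split.
- by rewrite card_prod card_ord cJ expnS.
- move=> [a j] /=; have hx := xE _ (mem_nth 0 lx).
  have h1 := msize_exp_le a hx; have h2 := hp j.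
  have aD : (a * E <= D * E)%N by rewrite leq_mul2r (ltnW (ltn_ord a)) orbT.
  apply: leq_trans (msizeM_le h1 h2) _.
  by rewrite addSn ltnS !mulSn mulnDl leq_add2r.
- move=> c h; apply: (@lin_indep_mod_powers M (in_seq_smul (take l x))
    (in_seq_smul (take l.+1 x)) x`_l J (fun j => p j *: v) D) => //.
  + by move=> u w; apply: in_seq_smul_take.
  + by move=> u; apply: regx.
  + by rewrite -eqS.
  by move: h; under eq_bigr do rewrite -scalerA.
Qed.

(** All monomials of the [p j] have their exponents below [B], so they lie in a cube [T] of [B ^ r]
    monomials. Independence makes the matrix [A] of coefficients row-free, and its rank is at most
    its number of columns. *)
Lemma card_lin_indep_le (J : finType) (p : J -> S) (B : nat) :
  (forall j, (msize (p j) <= B)%N) ->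
  (forall c : J -> K, \sum_j (c j)%:MP * p j = 0 -> forall j, c j = 0) ->
  (#|J| <= B ^ r)%N.
Proof.
move=> hB ind.
pose T := {ffun 'I_r -> 'I_B}.
pose mn (t : T) : 'X_{1..r} := [multinom (t i : nat) | i < r].
pose A : 'M[K]_(#|J|, #|T|) :=
  \matrix_(i, j) (p (enum_val i))@_(mn (enum_val j)).
have : row_free A.
  rewrite -kermx_eq0; apply/eqP/row_matrixP => i; rewrite row0.
  set u := row i _; have uA : u *m A = 0.
    by apply/sub_kermxP; apply: row_sub.
  have {}ind := ind (fun j => u 0 (enum_rank j)).
  apply/rowP => j; rewrite [RHS]mxE -[j]enum_valK; apply: ind.
  apply/mpolyP => m; rewrite mcoeff0 raddf_sum /=.
  (* A monomial outside the cube has degree at least [B], so it occurs in no [p j]. *)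
  have [mB|mB] := boolP [forall k : 'I_r, (m k < B)%N]; last first.
    rewrite big1 // => k _; rewrite mcoeffCM memN_msupp_eq0 ?mulr0 //.
    apply: contra mB => /msize_mdeg_lt mk; apply/forallP => l.
    apply: leq_trans (leq_trans mk (hB k)); rewrite ltnS mdegE.
    by rewrite (bigD1 l) //= leq_addr.
  move/forallP: mB => mB.
  have [t ->] : exists t : T, m = mn t.
    by exists [ffun k => Ordinal (mB k)]; apply/mnmP => k; rewrite mnmE ffunE.
  move/rowP/(_ (enum_rank t)): uA; rewrite !mxE => uA; rewrite -[RHS]uA.
  rewrite (reindex_onto enum_val enum_rank) //=; last by move=> *; exact: enum_rankK.
  apply: eq_big => [k|k _]; first by rewrite enum_valK eqxx.
  by rewrite mcoeffCM [A _ _]mxE enum_rankK enum_valK.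
move/eqP => <-; rewrite (leq_trans (rank_leq_col A)) //.
by rewrite card_ffun !card_ord.
Qed.

Lemma regular_seq_size (M : lmodType S) (x : seq S) : regular_seq M x -> (size x <= r)%N.
Proof.
move=> regx; have [_ _ [v vx]] := regx; rewrite leqNgt; apply/negP => rx.
pose E := (\max_(y <- x) msize y).+1.
have xE y : y \in x -> (msize y <= E)%N.
  move=> yx; rewrite /E (big_rem y) //=; apply: leqW; exact: leq_maxl.
(* With this [D], the [D ^ r.+1] independent polynomials obtained from [r.+1] entries exceed the
   bound [((r.+1 * E + 1) * D) ^ r] on the dimension. *)
pose D := ((r.+1 * E + 1) ^ r).+1.
have [J [p [cJ hp ind]]] := @regular_seq_indep M x v D E r.+1 regx vx xE rx.
have := @card_lin_indep_le J p (r.+1 * D * E).+1 hp.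
rewrite cJ => /(_ _)/wrap[].
  move=> c hc j; apply: ind => //.
  under eq_bigr do rewrite scalerA.
  by rewrite -scaler_suml hc scale0r; apply: in_seq_smul0.
apply/negP; rewrite -ltnNge.
apply: (@leq_ltn_trans (((r.+1 * E + 1) * D) ^ r)).
  have leqX e a b : (a <= b -> a ^ e <= b ^ e)%N.
    by move=> ab; elim: e => // e IHe; rewrite !expnS leq_mul.
  by apply: leqX; rewrite mulnDl mul1n mulnAC -addn1 leq_add2l.
by rewrite expnMn expnS ltn_pmul2r ?expn_gt0 // /D.
Qed.

End RegularSequences.

(** * The Hilbert series of S/I as a positive combination *)

(* The coefficient of t^k in (1-t)^-b; the truncation in [.-1] gives the right
   value 1 at b = k = 0. *)
Definition nmon (b k : nat) : nat := 'C((k + b).-1, k).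

(** Coefficient form of (1-t)^-(b+1) = (1-t)^-b + t (1-t)^-(b+1). *)
Lemma nmonS b k : nmon b.+1 k.+1 = nmon b k.+1 + nmon b.+1 k.
Proof. by rewrite /nmon addSn !addnS !addSn /= binS. Qed.

Lemma nmon0 b : nmon b 0 = 1. Proof. by rewrite /nmon bin0. Qed.

Lemma nmon0n k : nmon 0 k = (k == 0).
Proof. by case: k => [|k]; rewrite /nmon // addn0 bin_small. Qed.

(** The coefficient of t^a in t^k (1-t)^-b. *)
Definition nmon_shift (b k a : nat) : nat :=
  if k <= a then nmon b (a - k) else 0.

(** * Finite sums of the series t^k (1-t)^-b *)

Section Decomposition.
Local Open Scope nat_scope.

(** Repetitions in [L] serve as multiplicities. Each entry will become a summand of a graded module:
    [lo] will bound the length of a common regular sequence from below, and [hi] the number of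
    variables required. *)
Definition decomposable (lo hi : nat) (f : nat -> nat) : Prop :=
  exists L : seq (nat * nat), all (fun bk => lo <= bk.1 <= hi) L /\
    forall a, f a = \sum_(bk <- L) nmon_shift bk.1 bk.2 a.

Lemma decomposable_ext lo hi f g : f =1 g -> decomposable lo hi f -> decomposable lo hi g.
Proof. by move=> fg [L [hL Lf]]; exists L; split=> // a; rewrite -fg. Qed.

Lemma decomposable0 lo hi : decomposable lo hi (fun=> 0).
Proof. by exists [::]; split=> // a; rewrite big_nil. Qed.

Lemma decomposableD lo hi f g :
  decomposable lo hi f -> decomposable lo hi g -> decomposable lo hi (fun a => f a + g a).
Proof.
move=> [L [hL Lf]] [L' [hL' Lg]]; exists (L ++ L'); split; first by rewrite all_cat hL.
by move=> a; rewrite big_cat Lf Lg.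
Qed.

Lemma decomposable_mulnr lo hi f c :
  decomposable lo hi f -> decomposable lo hi (fun a => c * f a).
Proof.
move=> hf; elim: c => [|c IHc]; first exact: decomposable0.
by apply: decomposable_ext (decomposableD hf IHc) => a; rewrite mulSn.
Qed.

Lemma decomposable_sum lo hi n (f : nat -> nat -> nat) :
  (forall i, decomposable lo hi (f i)) -> decomposable lo hi (fun a => \sum_(i < n) f i a).
Proof.
move=> hf; elim: n => [|n IHn].
  by apply: decomposable_ext (decomposable0 _ _) => a; rewrite big_ord0.
by apply: decomposable_ext (decomposableD IHn (hf n)) => a; rewrite big_ord_recr.
Qed.

Lemma decomposable_nmon_shift lo hi b k :
  lo <= b <= hi -> decomposable lo hi (nmon_shift b k).
Proof. by move=> hb; exists [:: (b, k)]; split=> [|a]; rewrite ?big_seq1 //= hb. Qed.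

Lemma sum_nmon b a : \sum_(i < a.+1) nmon b i = nmon b.+1 a.
Proof.
elim: a => [|a IHa]; first by rewrite big_ord1 !nmon0.
by rewrite big_ord_recr /= IHa nmonS addnC.
Qed.

Lemma sum_nmon_shift b k a : \sum_(i < a.+1) nmon_shift b k i = nmon_shift b.+1 k a.
Proof.
rewrite /nmon_shift; case: leqP => ka.
  rewrite -sum_nmon -(big_mkord xpredT) -(big_mkord xpredT (nmon_shift b k)).
  rewrite (@big_cat_nat _ _ _ k 0 a.+1 _ _ (leq0n k) (leqW ka)) /=.
  rewrite big_nat_cond big1 ?add0n => [|i]; last by rewrite andbT /= => ik; rewrite /nmon_shift leqNgt ik.
  rewrite -{1}[k]add0n big_addn; have -> : a.+1 - k = (a - k).+1 by lia.
  by apply: eq_bigr => i _; rewrite /nmon_shift leq_addl addnK.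
by rewrite big1 // => i _; case: leqP => //; have := ltn_ord i; lia.
Qed.

(** Partial sums multiply the series by (1-t)^-1, which raises every exponent b by one. *)
Lemma decomposable_partial_sum lo hi f :
  decomposable lo hi f -> decomposable lo.+1 hi.+1 (fun a => \sum_(i < a.+1) f i).
Proof.
move=> [L [hL Lf]]; exists [seq (bk.1.+1, bk.2) | bk <- L]; split.
  by rewrite all_map; apply: sub_all hL => -[b k] /=; rewrite !ltnS.
move=> a /=; under eq_bigr do rewrite Lf.
rewrite exchange_big big_map; apply: eq_bigr => -[b k] _ /=.
exact: sum_nmon_shift.
Qed.

(* Pascal's rule splits the tail of (1-t)^-(b+1) from degree k+1 on into the
   same tail of (1-t)^-b and t times the tail of (1-t)^-(b+1) from degree k on. *)
Lemma decomposable_nmon_tail b k :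
  decomposable 0 b (fun a => if k <= a then nmon b a else 0).
Proof.
(* The induction lowers [b], so the upper bound [hi] is kept fixed. It also needs an additional
   shift by t^j, because Pascal's rule passes from [j] to [j.+1]. *)
suff : forall hi, b <= hi -> decomposable 0 hi (fun a => if k <= a then nmon b a else 0).
  exact.
move=> hi; suff : b <= hi -> forall j, decomposable 0 hi
    (fun a => if k + j <= a then nmon b (a - j) else 0).
  move=> + bhi => /(_ bhi 0); apply: decomposable_ext => a.
  by rewrite addn0 subn0.
elim: b k => [|b IHb] k bhi j.
  case: k => [|k]; first exact: (@decomposable_nmon_shift 0 hi 0 j).
  apply: decomposable_ext (decomposable0 _ _) => a; rewrite nmon0n.
  by rewrite addSn; have [h|//] := ltnP (k + j) a; have /negPf -> : a - j != 0 by lia.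
elim: k j => [|k IHk] j; first exact: (@decomposable_nmon_shift 0 hi b.+1 j).
apply: decomposable_ext (decomposableD (IHb k.+1 (ltnW bhi) j) (IHk j.+1)) => a.
rewrite addSn addnS; case: ltnP => // ka.
by have -> : a - j = (a - j.+1).+1 by [lia]; rewrite nmonS.
Qed.

(** Below degree [N] the series is a polynomial with nonnegative coefficients, hence a sum of terms
    t^i (1-t)^0, which the lower bound 0 admits. From degree [N] on it is a tail of (1-t)^-b plus a
    tail that is decomposable by hypothesis. *)
Lemma decomposable_ultimately b b' N f :
  (forall a, N <= a -> f a = nmon b a + b' a) ->
  decomposable 0 b (fun a => if N <= a then b' a else 0) ->
  decomposable 0 b f.
Proof.
move=> hf hb'.
have h1 : decomposable 0 b (fun a => \sum_(i < N) f i * nmon_shift 0 i a).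
  by apply: (@decomposable_sum 0 b N (fun i a => f i * nmon_shift 0 i a)) => i; apply: (@decomposable_mulnr 0 b (nmon_shift 0 i)); exact: decomposable_nmon_shift.
apply: decomposable_ext (decomposableD h1 (decomposableD (decomposable_nmon_tail b N) hb')) => a.
case: leqP => Na.
  rewrite big1 ?add0n ?hf // => i _; rewrite /nmon_shift nmon0n.
  have iN := ltn_ord i; case: leqP => _; last by rewrite muln0.
  by have /negPf -> : a - i != 0 by [lia]; rewrite muln0.
rewrite (bigD1 (Ordinal Na)) //= big1 => [|i /eqP ia].
  by rewrite /nmon_shift leqnn subnn nmon0 muln1 !addn0.
rewrite /nmon_shift nmon0n; case: leqP => ia'; last by rewrite muln0.
case: eqP => [e|_]; last by rewrite muln0.
by case: ia; apply: val_inj => /=; lia.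
Qed.

End Decomposition.

(** * Positivity and decomposition of the series (1-t)^d H *)

Section Numerics.
Local Open Scope ring_scope.

(* The coefficient of t^k in (1-t)^-z. *)
Definition inv_pow_coef (z : int) (k : nat) : int :=
  match z with
  | Posz b => (nmon b k)%:Z
  | Negz j => (-1) ^+ k * ('C(j.+1, k))%:Z
  end.

Lemma sum_inv_pow_coef z a : \sum_(i < a.+1) inv_pow_coef z i = inv_pow_coef (z + 1) a.
Proof.
case: z => [b|j].
  have -> : Posz b + 1 = Posz b.+1 by lia.
  by rewrite /= -sum_nmon -(big_morph Posz PoszD (erefl _)).
elim: a => [|a IHa].
  rewrite big_ord1 /= bin0; case: j => [|j] //=.
(* For [j] = 0 the exponent passes from -1 to 0, hence from the [Negz] branch to the [Posz] branch:
   the partial sums of 1-t are 1, 0, 0, and so on. *)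
rewrite big_ord_recr /= IHa; case: j {IHa} => [|j] /=.
  case: a => [|a]; first by [].
  by rewrite /nmon !addn0 /= !bin_small ?mulr0.
rewrite subn1 /= [in X in _ + X = _]binS PoszD exprS; ring.
Qed.

Lemma inv_pow_coef0 z : inv_pow_coef z 0 = 1.
Proof. by case: z => [b|j] /=; rewrite ?nmon0 ?bin0. Qed.


Lemma inv_pow_coef1 z : inv_pow_coef z 1 = z.
Proof.
case: z => [b|j] /=; last by rewrite expr1 bin1; lia.
by rewrite /nmon /= bin1.
Qed.

Lemma inv_pow_coef_oppn d k : inv_pow_coef (- d%:Z) k = (-1) ^+ k * ('C(d, k))%:Z.
Proof.
case: d => [|d]; last by rewrite -NegzE.
by rewrite oppr0 /= nmon0n bin0n; case: k => [|k] //=; rewrite mulr0.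
Qed.

(* Positivity of the coefficients of (1-t)^d H, where H is the Hilbert series
   of S/I and d = uphalf n. *)
Lemma inv_pow_coef_sum_ge0 (n m d k : nat) :
  (d <= n)%N -> (d.*2 <= n.+1)%N -> (m <= n)%N ->
  0 <= inv_pow_coef (n%:Z - d%:Z) k + inv_pow_coef (m%:Z - d%:Z) k
         - inv_pow_coef (- d%:Z) k.
Proof.
move=> dn n2 mn; have -> : n%:Z - d%:Z = Posz (n - d) by lia.
(* In degrees 0 and 1 the values are 1 and n + m - d. *)
case: k => [|[|k]]; first by rewrite !inv_pow_coef0.
  by rewrite !inv_pow_coef1; lia.
(* From degree 2 on, the upper index k + 1 + n - d of the binomial coefficient on the right is at
   least d because 2d <= n + 1. The first term then dominates the last one, whatever its sign. *)
have dk : ('C(d, k.+2) <= nmon (n - d) k.+2)%N.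
  by rewrite /nmon leq_bin2l //; lia.
rewrite inv_pow_coef_oppn /=.
have [dm|md] := leqP d m.
  have -> : m%:Z - d%:Z = Posz (m - d) by lia.
  rewrite /= -signr_odd; case: odd; rewrite ?expr1 ?expr0; lia.
have -> : m%:Z - d%:Z = - (d - m)%N%:Z by lia.
(* For m < d the last two terms carry opposite signs, so together they are at most ['C(d, k.+2)] in
   absolute value. *)
have md' : ('C(d - m, k.+2) <= 'C(d, k.+2))%N by rewrite leq_bin2l ?leq_subr.
rewrite inv_pow_coef_oppn -signr_odd; case: odd; rewrite ?expr1 ?expr0; lia.
Qed.

(** The series (1-t)^d H is decomposed with exponents between 0 and n - d. Then d successive partial
    sums restore H and move the exponents to the range from d to n. *)
Lemma decomposable_hilbert_series (n m : nat) : (m <= n)%N ->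
  decomposable (uphalf n) n (fun k => nmon n k + nmon m k - (k == 0))%N.
Proof.
move=> mn; set d := uphalf n.
have [dn d2] : (d <= n)%N /\ (d.*2 <= n.+1)%N.
  rewrite /d uphalf_half; have := odd_double_half n; move: (odd n) n./2 => o h <-.
  split; case: o; lia.
(* After [e] partial sums, [f] is the coefficient sequence of (1-t)^(d-e) H. *)
suff : forall e, (e <= d)%N -> exists2 f : nat -> nat, decomposable e (n - d + e) f &
    forall k, (f k)%:Z = inv_pow_coef (n%:Z - (d - e)%N%:Z) k
      + inv_pow_coef (m%:Z - (d - e)%N%:Z) k - inv_pow_coef (- (d - e)%N%:Z) k.
  move=> /(_ d (leqnn d))[f fdec fE].
  rewrite subnK // in fdec; apply: decomposable_ext fdec => k.
  have := fE k; rewrite subnn subr0 subr0 oppr0 /= nmon0n; lia.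
elim=> [_|e IHe ed]; last first.
  have [f fdec fE] := IHe (ltnW ed).
  exists (fun k => \sum_(i < k.+1) f i)%N.
    by rewrite addnS; apply: decomposable_partial_sum.
  move=> k; rewrite (big_morph Posz PoszD (erefl _)).
  under eq_bigr do rewrite fE.
  rewrite !big_split sumrN /= !sum_inv_pow_coef.
  by congr (inv_pow_coef _ _ + inv_pow_coef _ _ - inv_pow_coef _ _); lia.
rewrite subn0 addn0.
pose F k := inv_pow_coef (n%:Z - d%:Z) k + inv_pow_coef (m%:Z - d%:Z) k
         - inv_pow_coef (- d%:Z) k.
have F0 k : 0 <= F k by apply: inv_pow_coef_sum_ge0.
exists (fun k => `|F k|%N); last by move=> k; rewrite gez0_abs.
(* Beyond degree d the polynomial (1-t)^d contributes nothing, and neither does (1-t)^(d-m) when m <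
   d. *)
apply: (@decomposable_ultimately (n - d) (if (d <= m)%N then nmon (m - d) else fun=> 0)%N d.+1).
  move=> k dk; apply/eqP; rewrite -eqz_nat gez0_abs //.
  rewrite /F inv_pow_coef_oppn bin_small // mulr0 subr0.
  have -> : n%:Z - d%:Z = Posz (n - d) by lia.
  case: leqP => dm; first by have -> : m%:Z - d%:Z = Posz (m - d) by lia.
  have -> : m%:Z - d%:Z = - (d - m)%N%:Z by lia.
  rewrite inv_pow_coef_oppn bin_small ?mulr0 ?addr0 ?addn0 //; lia.
case: leqP => dm; last first.
  by apply: decomposable_ext (decomposable0 _ _) => k; rewrite if_same.
have [L [hL LE]] := decomposable_nmon_tail (m - d) d.+1.
exists L; split=> //; apply: sub_all hL => bk; lia.
Qed.

End Numerics.

(** * Monomial quotients *)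

Section IdealQuotient.
Variables (K : fieldType) (r : nat) (J : finType) (g : J -> {mpoly K[r]}).
Local Open Scope ring_scope.
Local Notation S := {mpoly K[r]}.

Lemma idealquot_pi_surj (v : idealquot g) : exists p : S, v = idealquot_pi g p.
Proof. exact: (@quotmod_pi_surj S S^o (ideal_gen g) v). Qed.

Lemma idealquot_piZ (a p : S) : idealquot_pi g (a * p) = a *: idealquot_pi g p.
Proof. exact: (@quotmod_piZ S S^o (ideal_gen g) a p). Qed.

Lemma idealquot_pi_eq0 (p : S) : idealquot_pi g p = 0 <-> p \in ideal_gen g.
Proof. exact: (@quotmod_pi_eq0 S S^o (ideal_gen g) p). Qed.

Lemma idealquot_pi_eq (p q : S) :
  idealquot_pi g p = idealquot_pi g q <-> p - q \in ideal_gen g.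
Proof.
rewrite -idealquot_pi_eq0.
have -> : idealquot_pi g (p - q) = idealquot_pi g p - idealquot_pi g q.
  exact: (@quotmod_piB S S^o (ideal_gen g) p q).
by split=> [->|/eqP]; [rewrite subrr|rewrite subr_eq0 => /eqP].
Qed.

End IdealQuotient.

Section MonomialQuotient.
Variables (K : fieldType) (r : nat) (J : finType).
Variables (g : J -> {mpoly K[r]}) (e : J -> 'X_{1..r}).
Hypothesis gE : forall j, g j = 'X_[e j].
Local Open Scope ring_scope.
Local Notation S := {mpoly K[r]}.

Lemma monomial_idealP (p : S) :
  p \in ideal_gen g <-> {in msupp p, forall m, [exists j, (e j <= m)%MM]}.
Proof.
split=> [/ideal_genP[c ->] m mp|hp].
  have [j mj] : exists j, m \in msupp (c j * g j).
    apply/existsP; apply: contraLR mp => /existsPn h.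
    rewrite mcoeff_msupp negbK raddf_sum big1 //= => j _.
    exact: memN_msupp_eq0.
  apply/existsP; exists j; move: mj => /msuppM_le/allpairsP[[m1 m2] /= [_ h2 ->]].
  by move: h2; rewrite gE msuppX inE => /eqP ->; apply: lem_addl.
rewrite [p]mpolyE big_seq; apply: rpred_sum => m /hp/existsP[j ejm].
apply/ideal_genP; exists (fun i => if i == j then p@_m *: 'X_[m - e j] else 0).
rewrite (bigD1 j) //= eqxx big1 => [|i /negPf ->]; last by rewrite mul0r.
by rewrite addr0 gE -scalerAl -mpolyXD submK.
Qed.

(** The classes of the monomials in [s] form a basis: the other monomials of a homogeneous
    representative lie in the ideal, and by [monomial_idealP] no nonzero combination of monomials
    outside the ideal lies in it. *)
Lemma has_dim_monomial_quotient (k : int) (s : seq 'X_{1..r}) :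
  uniq s ->
  (forall m, (m \in s) = ((mdeg m)%:Z == k) && ~~ [exists j, (e j <= m)%MM]) ->
  has_dim (@idealquot_gr K r J g k) (size s).
Proof.
move=> us sE; pose mon i := tnth (in_tuple s) i.
have monE i : mon i \in s by apply: mem_tnth.
have mon_inj : injective mon by apply/tuple_uniqP.
pose q (c : 'rV[K]_(size s)) : S := \sum_i c 0 i *: 'X_[mon i].
have qE (c : 'rV[K]_(size s)) : \sum_i (c 0 i)%:MP *: idealquot_pi g 'X_[mon i] = idealquot_pi g (q c).
  rewrite idealquot_pi_sum; apply: eq_bigr => i _.
  by rewrite -idealquot_piZ -mul_mpolyC.
have q_mon c i : (q c)@_(mon i) = c 0 i.
  rewrite raddf_sum (bigD1 i) //= mcoeffZ mcoeffX eqxx mulr1 big1 ?addr0 // => j ji.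
  by rewrite mcoeffZ mcoeffX (inj_eq mon_inj) (negPf ji) mulr0.
have q_out c m : m \notin s -> (q c)@_m = 0.
  move=> ms; rewrite raddf_sum big1 // => i _; rewrite /= mcoeffZ mcoeffX.
  by case: eqP => [im|_]; rewrite ?mulr0 //; rewrite -im monE in ms.
exists (fun i => idealquot_pi g 'X_[mon i]); split=> [i|v [p [hp ->]]].
  exists 'X_[mon i]; split=> // m; rewrite msuppX inE => /eqP ->.
  by have := monE i; rewrite sE => /andP[/eqP].
exists (\row_i p@_(mon i)); split=> [|c].
  rewrite qE; apply/idealquot_pi_eq/monomial_idealP => m; rewrite mcoeff_msupp mcoeffB.
  have [/(tnthP (in_tuple s))[i ->]|ms] := boolP (m \in s).
    by rewrite -/(mon i) q_mon mxE subrr eqxx.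
  rewrite q_out // subr0 -mcoeff_msupp => mp.
  by move: ms; rewrite sE (hp _ mp) eqxx negbK.
rewrite qE => /idealquot_pi_eq/monomial_idealP h; apply/rowP => i; rewrite mxE.
apply/eqP; rewrite -subr_eq0; apply: contraT => ci.
have /h : mon i \in msupp (p - q c) by rewrite mcoeff_msupp mcoeffB q_mon.
by have := monE i; rewrite sE => /andP[_ /negPf ->].
Qed.

End MonomialQuotient.

(** * Counting monomials of given degree in a set of variables *)

Section MonomialCount.
Variable r : nat.

(** For a chosen [i] in [A], a monomial of degree k + 1 either avoids the variable [i] (list [s1])
    or is that variable times a monomial of degree k (list [s2]). This is the recursion [nmonS]. *)
Lemma mdeg_support_enum (A : {set 'I_r}) k : exists s : seq 'X_{1..r},
  [/\ uniq s, forall m, (m \in s) = (mdeg m == k) && [forall i, (i \in A) || (m i == 0)]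
    & size s = nmon #|A| k].
Proof.
have deg0 (B : {set 'I_r}) m :
    (mdeg m == 0) && [forall i, (i \in B) || (m i == 0)] = (m \in [:: 0%MM]).
  rewrite mdeg_eq0 inE; case: eqP => //= ->.
  by apply/forallP => i; rewrite mnm0E eqxx orbT.
move cA: #|A| => b; elim: b A cA k => [|b IHb] A cA.
  move/eqP: cA; rewrite cards_eq0 => /eqP ->; case=> [|k].
    by exists [:: 0%MM]; split=> // m; rewrite -deg0.
  exists [::]; split=> // [m|]; last by rewrite nmon0n.
  rewrite in_nil; apply/esym/negP => /andP[+ /forallP h].
  suff -> : m = 0%MM by rewrite mdeg0.
  by apply/mnmP => i; rewrite mnm0E; apply/eqP; have := h i; rewrite inE.
have [i iA] : exists i, i \in A by apply/card_gt0P; rewrite cA.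
elim=> [|k [s2 [us2 s2E cs2]]].
  by exists [:: 0%MM]; split=> [//|m|]; [rewrite -(deg0 A)|rewrite nmon0].
have cAi : #|A :\ i| = b by apply/eqP; rewrite -eqSS -cA (cardsD1 i A) iA.
have [s1 [us1 s1E cs1]] := IHb _ cAi k.+1.
exists (s1 ++ [seq (m + U_(i))%MM | m <- s2]); split; last 1 first.
- by rewrite size_cat size_map cs1 cs2 nmonS.
- rewrite cat_uniq us1 map_inj_uniq ?us2 ?andbT /=; last exact: addIm.
  apply/hasPn => _ /mapP[m _ ->]; rewrite /= s1E; apply/nandP; right.
  apply/negP => /forallP/(_ i); rewrite !inE eqxx /= mnmDE mnm1E eqxx.
  by rewrite addn1.
- move=> m; rewrite mem_cat s1E; apply/idP/idP.
  + case/orP => [/andP[-> /forallP h]|/mapP[m' + ->]].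
      by apply/forallP => j; have := h j; rewrite !inE; case: (j \in A); rewrite ?andbT ?andbF.
    rewrite s2E mdegD mdeg1 addn1 eqSS => /andP[-> /forallP h].
    apply/forallP => j; have /orP[->//|/eqP mj] := h j.
    rewrite mnmDE mj mnm1E; case: (i =P j) => [<-|_]; last by rewrite orbT.
    by rewrite iA.
  + move=> /andP[mk /forallP h]; have [mi|mi] := eqVneq (m i) 0.
      apply/orP; left; rewrite mk; apply/forallP => j; rewrite !inE.
      by case: eqP => [->|_]; [rewrite mi|exact: h].
    apply/orP; right; apply/mapP; exists (m - U_(i))%MM; last first.
      by rewrite submK // lep1mP.
    have im : (U_(i) <= m)%MM by rewrite lep1mP.
    rewrite s2E; apply/andP; split.
      by rewrite -(eqn_add2r 1) [k + 1]addn1 -(mdeg1 i) -mdegD submK.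
    apply/forallP => j; have /orP[->//|/eqP mj] := h j.
    by rewrite mnmBE mj sub0n orbT.
Qed.

End MonomialCount.

(** * Quotients by sets of variables and their regular sequences *)

Section CoordinateQuotient.
Variables (K : fieldType) (r : nat).
Local Open Scope ring_scope.
Local Notation S := {mpoly K[r]}.

Definition coord_gen (T : {set 'I_r}) (i : {i | i \in T}) : S := 'X_(val i).

Lemma coord_gen_homog (T : {set 'I_r}) (i : {i | i \in T}) : coord_gen i \is 1.-homog.
Proof. by rewrite dhomogX /= mdeg1. Qed.

(** This is the polynomial ring in the variables outside [T], viewed as a module over [S]. Its
    Hilbert series is (1-t)^-b, where b is the number of those variables. *)
Definition coord_quotient (T : {set 'I_r}) : fgGrModule K r :=
  gr_idealquot (dg := fun=> 1%N) (@coord_gen_homog T).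

Lemma coord_exists_le (T : {set 'I_r}) (m : 'X_{1..r}) :
  [exists j : {i | i \in T}, (U_(val j) <= m)%MM] = [exists i in T, m i != 0%N].
Proof.
apply/existsP/exists_inP => [[[i iT] /=]|[i iT mi]]; first by rewrite lep1mP; exists i.
by exists (Sub i iT); rewrite lep1mP.
Qed.

Lemma coord_quotient_dim (T : {set 'I_r}) (k : int) :
  has_dim (@gr K r (coord_quotient T) k)
    (if k is Posz a then nmon #|~: T| a else 0).
Proof.
case: k => [a|a]; last first.
  by apply: (@has_dim_monomial_quotient _ _ _ _ (fun j => U_(val j)%MM) _ _ [::]).

have [s [us sE <-]] := mdeg_support_enum (~: T) a.
apply: (@has_dim_monomial_quotient _ _ _ _ (fun j => U_(val j)%MM)) => // m.
rewrite sE eqz_nat coord_exists_le negb_exists_in; congr (_ && _).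
by apply: eq_forallb => i; rewrite inE negbK implybE.
Qed.

(** The preimage in [S] of the submodule generated by the variables in [l] is the monomial ideal
    generated by the variables in [T] and [l]. Regularity thus becomes a question about single
    monomials. *)
Lemma in_seq_smul_coordP (T : {set 'I_r}) (l : seq 'I_r) (p : S) :
  in_seq_smul [seq 'X_i : S | i <- l] (idealquot_pi (@coord_gen T) p) <->
  {in msupp p, forall m : 'X_{1..r}, [exists i in [predU T & l], m i != 0%N]}.
Proof.
set x := [seq _ | i <- l].
have szx : size x = size l by rewrite size_map.
split=> [[w wE] m mp|hp].
  have [rep repE] := choice (fun i => idealquot_pi_surj (w i)).
  pose q := \sum_(i < size x) x`_i * rep i.
  have : p - q \in ideal_gen (@coord_gen T).
    apply/idealquot_pi_eq; rewrite wE idealquot_pi_sum.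
    by apply: eq_bigr => i _; rewrite repE idealquot_piZ.
  move/(monomial_idealP (e := fun j => U_(val j)%MM) (fun=> erefl)) => h.
  (* A monomial of [p] either occurs in [p - q], and then involves a variable of [T], or has the
     same coefficient in [q], and then involves a variable of [l]. *)
  have [/h|] := boolP (m \in msupp (p - q)).
    by rewrite coord_exists_le => /exists_inP[i iT mi]; apply/exists_inP; exists i; rewrite ?inE ?iT.
  rewrite mcoeff_msupp negbK mcoeffB subr_eq0 => /eqP pq.
  have [i mi] : exists i : 'I_(size x), m \in msupp (x`_i * rep i).
    apply/existsP; apply: contraLR mp => /existsPn hx.
    rewrite mcoeff_msupp negbK pq raddf_sum big1 //= => i _.
    exact: memN_msupp_eq0.
  have il : (i < size l)%N by rewrite -szx.
  have y0 : 'I_r by case: (l) il => // y.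
  move: mi; rewrite (nth_map y0) // => /msuppM_le/allpairsP[[m1 m2] /= [h1 _ ->]].
  move: h1; rewrite msuppX inE => /eqP ->.
  apply/exists_inP; exists (nth y0 l i); first by rewrite !inE mem_nth ?orbT.
  by rewrite mnmDE mnm1E eqxx.
rewrite [p]mpolyE big_seq idealquot_pi_sum; apply: in_seq_smul_sum => m /hp/exists_inP[i iTl mi].
have im : (U_(i) <= m)%MM by rewrite lep1mP.
have -> : p@_m *: 'X_[m] = (p@_m *: 'X_[m - U_(i)]) * 'X_i :> S.
  by rewrite -scalerAl -mpolyXD submK.
case/orP: iTl => [iT|il].
  suff -> : idealquot_pi (@coord_gen T) (p@_m *: 'X_[m - U_(i)] * 'X_i) = 0.
    exact: in_seq_smul0.
  apply/idealquot_pi_eq0/ideal_genP.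
  exists (fun j => if j == Sub i iT then p@_m *: 'X_[m - U_(i)] else 0).
  by rewrite (bigD1 (Sub i iT)) //= eqxx big1 ?addr0 // => j /negPf ->; rewrite mul0r.
rewrite mulrC idealquot_piZ.
have <- : x`_(index i l) = 'X_i by rewrite (nth_map i) ?index_mem // nth_index.
by apply: in_seq_smul_nth; rewrite szx index_mem.
Qed.

(** If a variable of [l] times a monomial is divisible by a variable from [T] or from earlier in
    [l], the two variables differ, so the divisor already divides the monomial. *)
Lemma coord_quotient_regular (T : {set 'I_r}) (l : seq 'I_r) :
  uniq l -> {in l, forall i, i \notin T} ->
  regular_seq (coord_quotient T) [seq 'X_i | i <- l].
Proof.
move=> ul lT; split=> [i|i|].
- rewrite size_map => il; have y0 : 'I_r by case: (l) il => // y.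
  by rewrite (nth_map y0) // mcoeffX -mdeg_eq0 mdeg1.
- rewrite size_map => il v; have y0 : 'I_r by case: (l) il => // y.
  have [p ->] := idealquot_pi_surj v; rewrite (nth_map y0) // -map_take.
  rewrite -idealquot_piZ => /in_seq_smul_coordP h; apply/in_seq_smul_coordP => m mp.
  have /h/exists_inP[j jTl] : (U_(nth y0 l i) + m)%MM \in msupp ('X_(nth y0 l i) * p).
    by rewrite mcoeff_msupp mulrC mcoeffMX -mcoeff_msupp.
  rewrite mnmDE mnm1E; case: (nth y0 l i =P j) => [ij _|_ mj]; last by apply/exists_inP; exists j.
  move: jTl; rewrite -ij !inE (negPf (lT _ (mem_nth y0 il))) /=.
  move=> /(nthP y0)[k]; rewrite (size_takel (ltnW il)) => ki.
  rewrite nth_take // => /eqP; rewrite nth_uniq //; last exact: ltn_trans il.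
  by rewrite ltn_eqF.
exists (idealquot_pi (@coord_gen T) 1) => /in_seq_smul_coordP/(_ 0%MM).
by rewrite msupp1 inE eqxx => /(_ isT)/exists_inP[i _]; rewrite mnm0E.
Qed.

End CoordinateQuotient.

(** * The Hilbert series of S/I *)

Section BipartiteHilbertSeries.
Variables (K : fieldType) (n m : nat).

(** The monomials outside I are those without any y and those without any x. Only the monomial 1 is
    of both types, which explains the correction in degree 0. *)
Lemma quotient_SI_dim (k : int) :
  has_dim (@gr K (n + m) (quotient_SI K n m) k)
    (if k is Posz a then (nmon n a + nmon m a - (a == 0))%N else 0).
Proof.
pose e (ij : 'I_n * 'I_m) := (U_(lshift m ij.1) + U_(rshift n ij.2))%MM.
have eE ij : xy_gen K ij = 'X_[e ij] by rewrite mpolyXD.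
case: k => [a|a]; last first.
  by apply: (@has_dim_monomial_quotient _ _ _ _ e _ _ [::]) .
have suppl l : [forall k, (k \in [set lshift m i | i : 'I_n]) || (l k == 0)] =
    [forall j, l (rshift n j) == 0].
  apply/forallP/forallP => h k.
    by have /orP[/imsetP[i _ /eqP]|//] := h (rshift n k); rewrite eq_rlshift.
  by case: (split_ordP k) => i ->; rewrite ?h ?orbT // imset_f.
have suppr l : [forall k, (k \in [set rshift n j | j : 'I_m]) || (l k == 0)] =
    [forall i, l (lshift m i) == 0].
  apply/forallP/forallP => h k.
    by have /orP[/imsetP[i _ /eqP]|//] := h (lshift m k); rewrite eq_lrshift.
  by case: (split_ordP k) => i ->; rewrite ?h ?orbT // imset_f.
have e_le l : ~~ [exists ij, (e ij <= l)%MM] =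
    [forall j, l (rshift n j) == 0] || [forall i, l (lshift m i) == 0].
  have e_leE ij : (e ij <= l)%MM = (l (lshift m ij.1) != 0) && (l (rshift n ij.2) != 0).
    rewrite -!lt0n; apply/mnm_lepP/andP => [h|[h1 h2] k].
      have := h (lshift m ij.1); have := h (rshift n ij.2).
      by rewrite !mnmDE !mnm1E !eqxx eq_lrshift eq_rlshift addn0 add0n.
    rewrite mnmDE !mnm1E; case: (split_ordP k) => i ->.
      by rewrite eq_rlshift addn0 eq_lshift; case: eqP => // <-.
    by rewrite eq_lrshift add0n eq_rshift; case: eqP => // <-.
  apply/idP/idP => [/existsPn h|].
    apply/orP; case: (boolP [forall j, l (rshift n j) == 0]) => [|/forallPn[j lj]]; [by left|right].
    apply/forallP => i.
    by have := h (i, j); rewrite e_leE /= lj andbT negbK.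
  case/orP => /forallP h; apply/existsPn => ij; rewrite e_leE.
    by rewrite (eqP (h _)) eqxx andbF.
  by rewrite (eqP (h _)) eqxx.
have [s1 [us1 s1E cs1]] := mdeg_support_enum [set lshift m i | i : 'I_n] a.
have [s2 [us2 s2E cs2]] := mdeg_support_enum [set rshift n i | i : 'I_m] a.
rewrite !card_imset ?card_ord in cs1 cs2; [|exact: rshift_inj|exact: lshift_inj].
have s12 l : l \in s1 -> l \in s2 -> a = 0.
  rewrite s1E s2E suppl suppr => /andP[/eqP <- /forallP hr] /andP[_ /forallP hl].
  apply/eqP; rewrite mdeg_eq0; apply/eqP/mnmP => k; rewrite mnm0E; apply/eqP.
  by case: (split_ordP k) => i ->.
(* In degree 0 the list [s2] would repeat the monomial 1 of [s1]. *)
pose s := s1 ++ (if a == 0 then [::] else s2).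
have -> : nmon n a + nmon m a - (a == 0) = size s.
  rewrite /s size_cat cs1; case: (eqVneq a 0) => [->|_]; first by rewrite !nmon0.
  by rewrite cs2 subn0.
apply: (@has_dim_monomial_quotient _ _ _ _ e) => //.
  rewrite /s cat_uniq us1 /=; case: eqP => // a0; rewrite us2 andbT.
  by apply/hasPn => l l2; apply/negP => l1; apply: a0; apply: s12 l1 l2.
move=> l; rewrite e_le mem_cat eqz_nat andb_orr -suppl -suppr -s1E -s2E.
case: eqP => // a0; rewrite in_nil orbF; apply/esym/orb_idr.
rewrite s1E s2E => /andP[l0 _]; rewrite l0; apply/forallP => k.
by move: l0; rewrite a0 mdeg_eq0 => /eqP ->; rewrite mnm0E eqxx orbT.
Qed.

End BipartiteHilbertSeries.

(** * Shifts and direct sums *)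

Section ModuleConstructions.
Variables (K : fieldType) (r : nat).
Local Open Scope ring_scope.
Local Notation S := {mpoly K[r]}.

Section Shift.
Variables (M : fgGrModule K r) (a : int).

(** The grading of M(-a), whose Hilbert series is t^a times that of [M]. *)
Definition shift_gr (k : int) (v : M) : Prop := gr (k - a) v.

Lemma shift_gr_scale (i : nat) (k : int) (p : S) v :
  p \is i.-homog -> shift_gr k v -> shift_gr (i%:Z + k) (p *: v).
Proof. by move=> hp hv; rewrite /shift_gr -addrA; apply: gr_scale. Qed.

Lemma shift_gr_span v : exists (s : seq int) (f : int -> M),
  (forall k, shift_gr k (f k)) /\ v = \sum_(k <- s) f k.
Proof.
have [s [f [hf ->]]] := gr_span v.
exists [seq k + a | k <- s], (fun k => f (k - a)); split=> [k|]; first exact: hf.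
by rewrite big_map; apply: eq_bigr => k _; rewrite addrK.
Qed.

Lemma shift_gr_free (s : seq int) (f : int -> M) :
  uniq s -> (forall k, shift_gr k (f k)) -> \sum_(k <- s) f k = 0 ->
  forall k, k \in s -> f k = 0.
Proof.
move=> us hf sum0 k ks; rewrite -(subrK a k).
apply: (@gr_free K r M [seq k - a | k <- s] (fun k => f (k + a))).
- by rewrite map_inj_uniq //; apply: addIr.
- by move=> j; have := hf (j + a); rewrite /shift_gr addrK.
- by rewrite big_map -[RHS]sum0; apply: eq_bigr => j _; rewrite subrK.
- exact: map_f.
Qed.

Definition shift_module : fgGrModule K r :=
  @FGGrModule K r M shift_gr (fun k => @gr_0 K r M (k - a)) (fun k => @gr_B K r M (k - a))
    shift_gr_scale shift_gr_span shift_gr_free (@gr_fg K r M).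

End Shift.

(** Multiplying [f k] by the multiplicity of [k] in [s] absorbs repetitions and gives 0 outside [s].
    Both components of an element of a direct sum can then be written over one common list of
    degrees. *)
Lemma gr_span_uniq (L : fgGrModule K r) (v : L) : exists (s : seq int) (f : int -> L),
  (forall k, gr k (f k)) /\
  forall s' : seq int, uniq s' -> {subset s <= s'} -> v = \sum_(k <- s') f k.
Proof.
have [s [f [hf ->]]] := gr_span v.
have grMn k n : gr k (f k *+ n).
  elim: n => [|n IHn]; first exact: gr_0.
  by rewrite mulrS -[f k *+ n]opprK; apply: gr_B => //; rewrite -sub0r; apply: gr_B => //; apply: gr_0.
exists s, (fun k => f k *+ count_mem k s); split=> // s' us'.
elim: s {grMn} => [_|x s IHs /allP /= /andP[xs' /allP /IHs ss']].
  by rewrite big_nil big1 // => k _; rewrite mulr0n.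
rewrite big_cons ss'; under [RHS]eq_bigr do rewrite mulrnDr.
rewrite big_split /=; congr (_ + _).
rewrite (bigD1_seq x) //= eqxx mulr1n big1 ?addr0 // => k.
by rewrite eq_sym => /negPf ->.
Qed.

Lemma split_lshift n1 n2 (i : 'I_n1) : split (lshift n2 i) = inl i.
Proof. exact: (unsplitK (inl i)). Qed.

Lemma split_rshift n1 n2 (i : 'I_n2) : split (rshift n1 i) = inr i.
Proof. exact: (unsplitK (inr i)). Qed.

(** * Direct sums of graded modules *)

Section DirectSum.
Variables M N : fgGrModule K r.

Definition dsum_gr (k : int) (v : M * N) : Prop := gr k v.1 /\ gr k v.2.

Lemma dsum_gr0 k : dsum_gr k 0. Proof. by split; apply: gr_0. Qed.

Lemma dsum_grB k u v : dsum_gr k u -> dsum_gr k v -> dsum_gr k (u - v).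
Proof. by move=> [? ?] [? ?]; split; apply: gr_B. Qed.

Lemma dsum_gr_scale (i : nat) (k : int) (p : S) v :
  p \is i.-homog -> dsum_gr k v -> dsum_gr (i%:Z + k) (p *: v).
Proof. by move=> hp [? ?]; split; apply: gr_scale. Qed.

Lemma pair_sum (I : Type) (s : seq I) (F : I -> M) (G : I -> N) :
  \sum_(i <- s) ((F i, G i) : M * N) = (\sum_(i <- s) F i, \sum_(i <- s) G i).
Proof. by rewrite [LHS]surjective_pairing !raddf_sum. Qed.

Lemma dsum_gr_span v : exists (s : seq int) (f : int -> (M * N)%type),
  (forall k, dsum_gr k (f k)) /\ v = \sum_(k <- s) f k.
Proof.
have [s1 [f1 [gr1 v1]]] := gr_span_uniq v.1; have [s2 [f2 [gr2 v2]]] := gr_span_uniq v.2.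
pose s := undup (s1 ++ s2); have us : uniq s by apply: undup_uniq.
exists s, (fun k => (f1 k, f2 k)); split=> [k|]; first by split; [apply: gr1|apply: gr2].
rewrite pair_sum -v1 -?v2 -?surjective_pairing // => k ks;
  by rewrite mem_undup mem_cat ks ?orbT.
Qed.

Lemma dsum_gr_free (s : seq int) (f : int -> (M * N)%type) :
  uniq s -> (forall k, dsum_gr k (f k)) -> \sum_(k <- s) f k = 0 ->
  forall k, k \in s -> f k = 0.
Proof.
move=> us hf sum0 k ks; rewrite [f k]surjective_pairing.
have -> : (f k).1 = 0.
  apply: (@gr_free K r M s (fun k => (f k).1)) => // [j|]; first by have [] := hf j.
  by rewrite -(raddf_sum fst) sum0.
suff -> : (f k).2 = 0 by [].
apply: (@gr_free K r N s (fun k => (f k).2)) => // [j|]; first by have [] := hf j.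
by rewrite -(raddf_sum snd) sum0.
Qed.

Lemma dsum_fg : exists (l : nat) (e : 'I_l -> (M * N)%type),
  forall v, exists c : 'I_l -> S, v = \sum_i c i *: e i.
Proof.
have [l1 [e1 h1]] := @gr_fg K r M; have [l2 [e2 h2]] := @gr_fg K r N.
exists (l1 + l2)%N, (fun i => match split i with inl j => (e1 j, 0) | inr j => (0, e2 j) end).
move=> [u v]; have [c1 ->] := h1 u; have [c2 ->] := h2 v.
exists (fun i => match split i with inl j => c1 j | inr j => c2 j end).
rewrite big_split_ord /=.
under [X in _ = X + _]eq_bigr => i _ do rewrite split_lshift.
under [X in _ = _ + X]eq_bigr => i _ do rewrite split_rshift.
rewrite [RHS]surjective_pairing /= !raddf_sum /=.
by congr pair; [rewrite [X in _ = _ + X]big1|rewrite [X in _ = X + _]big1];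
  rewrite ?addr0 ?add0r // => i _; rewrite scaler0.
Qed.

Definition dsum_module : fgGrModule K r :=
  @FGGrModule K r (M * N)%type dsum_gr dsum_gr0 dsum_grB dsum_gr_scale
    dsum_gr_span dsum_gr_free dsum_fg.

Lemma has_dim_dsum k d1 d2 :
  has_dim (@gr K r M k) d1 -> has_dim (@gr K r N k) d2 ->
  has_dim (@gr K r dsum_module k) (d1 + d2).
Proof.
move=> [e1 [he1 h1]] [e2 [he2 h2]].
exists (fun i => match split i with inl j => (e1 j, 0) | inr j => (0, e2 j) end).
have sumE (c : 'rV[K]_(d1 + d2)) : \sum_i (c 0 i)%:MP *:
      (match split i with inl j => (e1 j, 0) | inr j => (0, e2 j) end : M * N) =
    (\sum_i (lsubmx c 0 i)%:MP *: e1 i, \sum_i (rsubmx c 0 i)%:MP *: e2 i).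
  rewrite big_split_ord /=.
  under [X in X + _]eq_bigr => i _ do rewrite split_lshift.
  under [X in _ + X]eq_bigr => i _ do rewrite split_rshift.
  rewrite [LHS]surjective_pairing /= !raddf_sum /=.
  by congr pair; [rewrite [X in _ + X]big1 ?addr0|rewrite [X in X + _]big1 ?add0r];
    try (by move=> i _; rewrite scaler0); apply: eq_bigr => i _; rewrite mxE.
split=> [i|[u v] [/h1[c1 [c1E c1U]] /h2[c2 [c2E c2U]]]].
  by case: (split i) => j; split=> //=; apply: gr_0.
exists (row_mx c1 c2); split=> [|c].
  by rewrite sumE row_mxKl row_mxKr -c1E -c2E.
rewrite sumE => -[/c1U -> /c2U ->]; exact: hsubmxK.
Qed.

Lemma in_seq_smul_dsum (x : seq S) (v : dsum_module) :
  in_seq_smul x v <-> in_seq_smul x (v : M * N).1 /\ in_seq_smul x (v : M * N).2.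
Proof.
case: v => u v; split=> [[w wE]|[[w1 /= ->] [w2 /= ->]]]; last first.
  exists (fun i => (w1 i, w2 i)).
  by rewrite [RHS]surjective_pairing !raddf_sum.
by split; [exists (fun i => (w i).1)|exists (fun i => (w i).2)];
  rewrite wE raddf_sum.
Qed.

Lemma regular_seq_dsum (x : seq S) :
  regular_seq M x -> regular_seq N x -> regular_seq dsum_module x.
Proof.
move=> [x0 regM [u ux]] [_ regN _]; split=> // [i ix v|].
  by move=> /in_seq_smul_dsum[/regM h1 /regN h2]; apply/in_seq_smul_dsum; auto.
by exists (u, 0) => /in_seq_smul_dsum[].
Qed.

End DirectSum.

End ModuleConstructions.

(** * Hilbert depth *)

Lemma exists_max_nat (P : nat -> Prop) (B d0 : nat) :
  P d0 -> (forall d, P d -> d <= B) ->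
  exists d, P d /\ forall d', P d' -> d' <= d.
Proof.
move=> Pd0 PB; have exP : exists d, `[< P d >] by exists d0; apply/asboolP.
have bP d : `[< P d >] -> d <= B by move/asboolP/PB.
by have [d /asboolP Pd dmax] := ex_maxnP exP bP; exists d; split=> // d' /asboolP/dmax.
Qed.

Section HilbertDepth.
Variables (K : fieldType) (r : nat).

(** The maximum exists because [regular_seq_size] bounds all lengths by [r]. *)
Lemma regular_seq_depth (M : lmodType {mpoly K[r]}) x : regular_seq M x ->
  exists d, is_depth M d /\ size x <= d.
Proof.
move=> regx.
have [||d [[y [regy yd]] dmax]] :=
  @exists_max_nat (fun d => exists y, regular_seq M y /\ size y = d) r (size x).
- by exists x.
- by move=> d [y [regy <-]]; apply: regular_seq_size regy.
exists d; split; last by apply: dmax; exists x.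
by split=> [|z regz]; [exists y|apply: dmax; exists z].
Qed.

(** The depths of all competing modules are at most [r], so a maximum exists, and the module [N]
    bounds it from below. *)
Lemma hdepth_exists (M N : fgGrModule K r) x :
  same_hilbert_series M N -> regular_seq N x ->
  exists d, is_hdepth M d /\ size x <= d.
Proof.
move=> MN regx; have [dN [NdN xdN]] := regular_seq_depth regx.
have [||d [Pd dmax]] := @exists_max_nat
  (fun d => exists N, same_hilbert_series M N /\ is_depth N d) r dN.
- by exists N.
- by move=> d [N' [_ [[y [regy <-]] _]]]; apply: regular_seq_size regy.
exists d; split; last by apply: leq_trans xdN (dmax _ _); exists N.
by split=> // N' d' MN' N'd'; apply: dmax; exists N'.
Qed.

(** One sequence, the first [d] variables, is regular on every summand because each exponent is at
    least [d]; it is therefore regular on the direct sum. *)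
Lemma decomposable_regular_module (d : nat) (L : seq (nat * nat)) :
  L != [::] -> d <= r -> all (fun bk => d <= bk.1 <= r) L ->
  exists (N : fgGrModule K r) (x : seq {mpoly K[r]}),
    [/\ has_hilbert_series N
          (fun k => if k is Posz a then \sum_(bk <- L) nmon_shift bk.1 bk.2 a else 0),
        regular_seq N x & size x = d].
Proof.
move=> L0 dr hL.
pose l := [seq widen_ord dr i | i <- enum 'I_d].
have szl : size l = d by rewrite size_map size_enum_ord.
pose x : seq {mpoly K[r]} := [seq mpolyX K U_(i) | i <- l].
suff : exists N : fgGrModule K r, has_hilbert_series N
          (fun k => if k is Posz a then \sum_(bk <- L) nmon_shift bk.1 bk.2 a else 0) /\
        regular_seq N x.
  by move=> [N [hN regN]]; exists N, x; rewrite size_map szl.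
have base b k0 : d <= b <= r -> exists N : fgGrModule K r, has_hilbert_series N
          (fun k => if k is Posz a then nmon_shift b k0 a else 0) /\ regular_seq N x.
  move=> /andP[db br].
  (* Killing these variables leaves exactly the first [b], among them the [d] variables in [x]. *)
  pose T := [set i : 'I_r | b <= i].
  exists (shift_module (coord_quotient K T) k0%:Z); split=> [k|].
    have := coord_quotient_dim K T (k - k0%:Z)%R.
    have -> : #|~: T| = b.
      rewrite -sum1_card; under eq_bigl do rewrite !inE -ltnNge.
      by rewrite -(big_ord_widen r (fun=> 1) br) sum_nat_const card_ord muln1.
    suff -> : (if (k - k0%:Z)%R is Posz a then nmon b a else 0) =
        (if k is Posz a then nmon_shift b k0 a else 0) by [].
    case: k => a; last first.
      by have -> : (Negz a - k0%:Z)%R = Negz (a + k0) by lia.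
    rewrite /nmon_shift; case: leqP => h; first by rewrite subzn.
    by have -> : (a%:Z - k0%:Z)%R = Negz (k0 - a).-1 by lia.
  apply: coord_quotient_regular => [|_ /mapP[i _ ->]].
    by rewrite map_inj_uniq ?enum_uniq // => i j /(congr1 val) ij; apply: val_inj.
  by rewrite inE -ltnNge /= (leq_trans (ltn_ord i)).
elim: L L0 hL => // -[b k0] L IHL _ /= /andP[hb hL].
have [N [hN regN]] := base b k0 hb.
(* The induction starts from a single summand, as the zero module has no regular sequence. *)
case: L IHL hL => [|bk L] IHL hL.
  exists N; split=> // k; have := hN k.
  by case: k => // a; rewrite big_seq1.
have [N' [hN' regN']] := IHL isT hL.
exists (dsum_module N N'); split; last exact: regular_seq_dsum.
move=> k; have := has_dim_dsum (hN k) (hN' k).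
by case: k => // a; rewrite [in X in _ -> X]big_cons.
Qed.
End HilbertDepth.

Theorem corollary2p4 (K : fieldType) (n m : nat) (hm : 1 <= m) (hmn : m <= n) :
  exists d : nat, is_hdepth (quotient_SI K n m) d /\ uphalf n <= d.
Proof.
have [L [hL LE]] := decomposable_hilbert_series hmn.
have hn : uphalf n <= n by rewrite leq_uphalf_double -addnn leq_addr.
(* In degree 0 the Hilbert function is 1 + 1 - 1 = 1, whereas an empty sum gives 0. *)
have L0 : L != [::].
  by apply/eqP => L0; have := LE 0; rewrite L0 big_nil !nmon0.
have [||N [x [hN regx <-]]] := @decomposable_regular_module K (n + m) (uphalf n) L L0.
- exact: leq_trans hn (leq_addr _ _).
- apply: sub_all hL => bk /andP[-> h]; exact: leq_trans h (leq_addr _ _).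
apply: hdepth_exists regx.
exists (fun k => if k is Posz a then \sum_(bk <- L) nmon_shift bk.1 bk.2 a else 0).
split=> // k; have := quotient_SI_dim K n m k.
by case: k => // a; rewrite LE.
Qed.
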